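(* Let $(f,G):E\to\mathbb{R}\times X$ be a $1$-jet defined on a nonempty subset $E$ of a Hilbert space $(X,|\cdot|)$. There exists $F\in C^{1,\omega}(X)$ with $(F,\nabla F)=(f,G)$ on $E$ if and only if $A(f,G)<\infty$. Moreover, in that case $F$ can be chosen so that $$A(F,\nabla F)\le 2\,A(f,G).$$
   Context: Spaces are real. $\omega:[0,\infty)\to[0,\infty)$ is a modulus of continuity: a concave, increasing, continuous function with $\omega(0)=0$ and $\lim_{t\to\infty}\omega(t)=\infty$. Put $\varphi(t)=\int_0^t\omega(s)\,ds$ for $t\ge0$. A $1$-jet on $E\subseteq X$ is a pair of functions $f:E\to\mathbb{R}$, $G:E\to X$ (the dual of $X$ is identified with $X$). $C^{1,\omega}(X)$ is the set of Fréchet differentiable $g:X\to\mathbb{R}$ for which there is a constant $C>0$ with $|\nabla g(x)-\nabla g(y)|\le C\,\omega(|x-y|)$ for all $x,y\in X$. For a $1$-jet $(f,G)$ on $E$, $$A(f,G)=\sup_{x\in X;\ y,z\in E,\ |x-y|+|x-z|>0}\frac{|f(y)+\langle G(y),x-y\rangle-f(z)-\langle G(z),x-z\rangle|}{\varphi(|x-y|)+\varphi(|x-z|)}\in[0,\infty].$$ For differentiable $F:X\to\mathbb{R}$, $A(F,\nabla F)$ is this quantity for the jet $(F,\nabla F)$ on $E=X$. *)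

(* Defs.v *)
From HB Require Import structures.
From mathcomp Require Import all_boot all_order all_algebra.
From mathcomp Require Import all_classical all_reals all_analysis.

Set Implicit Arguments.
Unset Strict Implicit.
Unset Printing Implicit Defensive.

Import Order.TTheory GRing.Theory Num.Theory.
Import numFieldNormedType.Exports.

Local Open Scope classical_set_scope.
Local Open Scope ring_scope.

(* A modulus of continuity is a map [0, +oo[ -> [0, +oo[; it is represented by
   a function on R of which only the values on [0, +oo[ matter. *)
Record modulus_of_continuity (R : realType) (omega : R -> R) : Prop := {
  modulus_ge0 : forall t, 0 <= t -> 0 <= omega t;
  modulus_concave :
    convex_function (`[0, +oo[%classic : set R) (fun t => - omega t);
  modulus_increasing : forall s t, 0 <= s -> s < t -> omega s < omega t;
  modulus_continuous : {within `[0, +oo[%classic, continuous omega};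
  modulus0 : omega 0 = 0;
  modulus_cvg_pinfty : omega t @[t --> +oo] --> +oo
}.

Definition modulus_primitive (R : realType) (omega : R -> R) (t : R) : R :=
  \int[lebesgue_measure]_(s in `[0, t]) omega s.

(* The Riesz representative of the Frechet derivative: the value 0 of [xget]
   is only taken as a default when 'd F x is not of the form dot v, which does
   not occur at points of differentiability in a Hilbert space. *)
Definition gradient (R : realType) (X : normedModType R)
    (dot : {dot X for idfun}) (F : X -> R) (x : X) : X :=
  xget 0 [set v | forall h, 'd F x h = dot v h].

Definition C1omega (R : realType) (X : normedModType R)
    (dot : {dot X for idfun}) (omega : R -> R) (g : X -> R) : Prop :=
  (forall x, differentiable g x) /\
  exists2 C : R, 0 < C & forall x y,
    `|gradient dot g x - gradient dot g y| <= C * omega `|x - y|.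

(* The 1-jet on E is given by total functions f and G of which only the values
   on E are used. The supremum is taken in [0, +oo], i.e., it is 0 when no
   triple is admissible (as happens for X = 0). *)
Definition jetA (R : realType) (X : normedModType R) (dot : {dot X for idfun})
    (omega : R -> R) (E : set X) (f : X -> R) (G : X -> X) : \bar R :=
  maxe 0%E (ereal_sup [set a : \bar R | exists x y z,
    [/\ E y, E z, 0 < `|x - y| + `|x - z| &
      a = (`|f y + dot (G y) (x - y) - f z - dot (G z) (x - z)| /
           (modulus_primitive omega `|x - y|
            + modulus_primitive omega `|x - z|))%:E]]).

(* Main.v *)
Require Import Defs.
From HB Require Import structures.
From mathcomp Require Import all_boot all_order all_algebra.
From mathcomp Require Import all_classical all_reals all_analysis.
From mathcomp Require Import ring lra.

Set Implicit Arguments.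
Unset Strict Implicit.
Unset Printing Implicit Defensive.

Import Order.TTheory GRing.Theory Num.Theory.
Import numFieldNormedType.Exports.

Local Open Scope classical_set_scope.
Local Open Scope ring_scope.

(** Write phi for the primitive of omega, p(x) = phi |x|, and M = A(f, G).
    Testing A at triples of the form (x, y, x) shows that, for F on the whole
    space, A(F, grad F) <= K amounts to the first order Taylor estimate

      |F(z + h) - F(z) - <grad F(z), h>| <= K phi |h|      for all z and h,

    and that this estimate makes grad F uniformly continuous with modulus a
    multiple of omega ([jet_modulus_of_remainder]). Conversely the mean value
    theorem and t omega(t) <= 2 phi(t) give such an estimate for any F of class
    C^{1,omega} ([C1omega_remainder]), so that A(f, G) is finite whenever (f, G)
    has an extension.

    For the existence of an extension, the definition of M says that each of
    the lower functions f(z) + <G(z), . - z> - M p(. - z) lies below each of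
    the upper functions f(y) + <G(y), . - y> + M p(. - y), for y, z in E. Any F
    in between coincides with f on E and has there the Taylor estimate with
    gradient G. It remains to find such an F that has the estimate with K = 2M
    everywhere. The estimate is replaced by its three-point form, in which no
    gradient occurs: F and -F should be K-paraconvex ([paraconvex]), i.e.,
    convex up to an error bounded in terms of phi. Two facts carry the proof.

    - In a Hilbert space p is superdifferentiable with remainder 2p:
      phi |w + h| <= phi |w| + <v, h> + 2 phi |h| for
      v = omega(|w|) w / |w| ([primitive_norm_superdifferential]). This is where
      the factor 2 comes from. Consequently the lower functions, and the
      opposites of the upper ones, are 2M-paraconvex.

    - Let F be the supremum of all 2M-paraconvex functions lying below all the
      upper functions ([paraconvex_sandwich]). It is 2M-paraconvex as a
      supremum. For fixed d and l, the function
      w |-> l F(w + (1 - l) d) + (1 - l) F(w - l d) - (error)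
      is again 2M-paraconvex, and it lies below the upper functions because
      their opposites are paraconvex; by maximality it is below F, which means
      that -F is 2M-paraconvex too.

    Finally, when F and -F are K-paraconvex, the difference quotients of F at a
    point converge, as phi(t) = o(t), to a bounded linear form D for which the
    Taylor estimate holds ([paraconvex_differential]), and Riesz representation
    turns D into a gradient. *)

(** * The modulus and its primitive *)

Section Modulus.
Variables (R : realType) (omega : R -> R).
Hypothesis omega_modulus : modulus_of_continuity omega.
Local Notation phi := (modulus_primitive omega).

Lemma modulus_le (s t : R) : 0 <= s -> s <= t -> omega s <= omega t.
Proof.
move=> s0; rewrite le_eqVlt => /predU1P[->//|st].
exact/ltW/(modulus_increasing omega_modulus).
Qed.

Lemma modulus_gt0 (t : R) : 0 < t -> 0 < omega t.
Proof.
move=> t0; rewrite -(modulus0 omega_modulus).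
exact: (modulus_increasing omega_modulus).
Qed.

(** Concavity together with omega 0 = 0 makes omega t / t nonincreasing; the
    quotients are cleared so that s = 0 is covered. *)
Lemma modulus_slope (s r : R) : 0 <= s -> s <= r -> s * omega r <= r * omega s.
Proof.
move=> s0 sr; have [r0|r0] := leP r 0.
  have -> : s = 0 by lra.
  have -> : r = 0 by lra.
  by [].
have l01 : (0 <= s / r <= 1)%R.
  by rewrite divr_ge0 ?(ltW r0)//= ler_pdivrMr// mul1r.
have [t tE] : exists t : {i01 R}, t%:num = s / r.
  by exists (Itv01 (andP l01).1 (andP l01).2).
have := modulus_concave omega_modulus t.
move=> /(_ r 0); rewrite !inE /= !in_itv/= !andbT (ltW r0) lexx.
move=> /(_ erefl erefl).
have -> : conv t (r : convex_lmodType R) 0 = s.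
  rewrite /conv/= scaler0 addr0 tE /GRing.scale/= divfK// gt_eqF//.
rewrite convRE tE (modulus0 omega_modulus) oppr0 mulr0 addr0.
rewrite mulrN lerN2 mulrAC ler_pdivrMr//.
by rewrite [omega s * r]mulrC.
Qed.

Lemma modulus_integrable (r : R) :
  lebesgue_measure.-integrable `[0, r] (EFin \o omega).
Proof.
apply: continuous_compact_integrable; first exact: segment_compact.
apply: continuous_subspaceW (modulus_continuous omega_modulus).
by move=> x /=; rewrite !in_itv/= => /andP[->].
Qed.

Lemma primitive_is_derive (x : R) : 0 < x -> is_derive x 1 phi (omega x).
Proof.
move=> x0; have xu : x < x + 1 by rewrite ltrDl.
have [|h1 h2] := continuous_FTC1_closed xu (modulus_integrable (x + 1)) x0.
  apply: (@within_continuous_continuous _ _ _ 0 (x + 1)).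
  - exact: lt_trans x0 xu.
  - apply: continuous_subspaceW (modulus_continuous omega_modulus).
    by move=> y /=; rewrite !in_itv/= => /andP[->].
  - by rewrite in_itv/= x0.
by split; [exact: h1|rewrite -derive1E; exact: h2].
Qed.

Lemma primitive_continuous (r : R) : {within `[0, r], continuous phi}.
Proof.
have [r0|r0] := leP 0 r.
  exact: parameterized_integral_continuous (modulus_integrable r).
rewrite set_itv_ge; last by rewrite bnd_simp -ltNge.
exact: continuous_subspace0.
Qed.

Lemma primitive0 : phi 0 = 0.
Proof. by rewrite /modulus_primitive set_itv1 Rintegral_set1. Qed.

(** The mean value theorem for phi t - c t^2. With c = 0 it compares phi with
    its tangents, with c = omega a / (2 a) with the parabola touching it at a. *)
Lemma primitive_increment (a b c : R) : 0 <= a -> a <= b ->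
  exists2 t, t \in `[a, b] &
    phi b - phi a - c * (b ^+ 2 - a ^+ 2) = (omega t - 2 * c * t) * (b - a).
Proof.
move=> a0 ab.
pose k t := phi t - c * t ^+ 2.
have [t tab e] : exists2 t, t \in `[a, b] &
    k b - k a = (omega t - 2 * c * t) * (b - a).
  apply: MVT_segment => //.
    move=> x; rewrite in_itv/= => /andP[ax xb].
    have := primitive_is_derive (le_lt_trans a0 ax) => ?.
    apply: is_derive_eq.
    by rewrite /GRing.scale/=; ring.
  have sub : `[a, b] `<=` `[0, b].
    by move=> x /=; rewrite !in_itv/= => /andP[ax ->]; rewrite (le_trans a0 ax).
  apply: within_continuousB.
    apply: (continuous_subspaceW sub); exact: primitive_continuous.
  apply: continuous_subspaceT => x.
  by apply: cvgM; [exact: cvg_cst|exact: exprn_continuous].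
by exists t => //; rewrite -e /k; ring.
Qed.

Lemma primitive_ge_tangent (s t : R) : 0 <= s -> 0 <= t ->
  phi s + omega s * (t - s) <= phi t.
Proof.
move=> s0 t0; have [st|/ltW ts] := leP s t.
  have [u +] := primitive_increment 0 s0 st.
  rewrite in_itv/= => /andP[su ut] e.
  have := modulus_le s0 su; nra.
have [u +] := primitive_increment 0 t0 ts.
rewrite in_itv/= => /andP[su ut] e.
have := modulus_le (le_trans t0 su) ut; nra.
Qed.

(** As a function of t^2, phi has derivative omega t / (2 t), which is
    nonincreasing: it is concave, hence below its tangents. Squares of norms are
    polynomial in the inner product, which makes this bound usable in a Hilbert
    space. *)
Lemma primitive_le_parabola (a t : R) : 0 < a -> 0 <= t ->
  phi t <= phi a + omega a / (2 * a) * (t ^+ 2 - a ^+ 2).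
Proof.
move=> a0 t0; set c := omega a / (2 * a).
have ca : 2 * c * a = omega a by rewrite /c; field; rewrite gt_eqF.
have [st|/ltW ts] := leP a t.
  have [u +] := primitive_increment c (ltW a0) st.
  rewrite in_itv/= => /andP[su ut] e.
  have h := modulus_slope (ltW a0) su.
  have : omega u <= 2 * c * u.
    by rewrite -(ler_pM2l a0); apply: le_trans h _; rewrite -ca; lra.
  nra.
have [u +] := primitive_increment c t0 ts.
rewrite in_itv/= => /andP[su ut] e.
have h := modulus_slope (le_trans t0 su) ut.
have : 2 * c * u <= omega u.
  by rewrite -(ler_pM2l a0); apply: le_trans h; rewrite -ca; lra.
nra.
Qed.

Lemma primitive_le (s t : R) : 0 <= s -> s <= t -> phi s <= phi t.
Proof.
move=> s0 st; have := primitive_ge_tangent s0 (le_trans s0 st).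
have := modulus_ge0 omega_modulus s0; nra.
Qed.

Lemma primitive_ge0 (t : R) : 0 <= t -> 0 <= phi t.
Proof. by move=> t0; rewrite -primitive0; exact: primitive_le. Qed.

Lemma primitive_le_mul (t : R) : 0 <= t -> phi t <= t * omega t.
Proof.
move=> t0; have := primitive_ge_tangent t0 (lexx 0); rewrite primitive0; lra.
Qed.

Lemma primitive_ge_half_mul (t : R) : 0 <= t -> t * omega t <= 2 * phi t.
Proof.
rewrite le_eqVlt => /predU1P[<-|t0]; first by rewrite primitive0; lra.
have := primitive_le_parabola t0 (lexx 0); rewrite primitive0.
have -> : omega t / (2 * t) * (0 ^+ 2 - t ^+ 2) = - (t * omega t / 2).
  by field; rewrite gt_eqF.
lra.
Qed.

Lemma primitive_gt0 (t : R) : 0 < t -> 0 < phi t.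
Proof.
move=> t0; have := primitive_ge_half_mul (ltW t0).
have : 0 < t * omega t by rewrite mulr_gt0// modulus_gt0.
lra.
Qed.

Lemma modulus_small (e : R) : 0 < e -> exists2 d : R, 0 < d & omega d < e.
Proof.
move=> e0.
have /continuous_within_itvP : {within `[0, 1], continuous omega}.
  apply: continuous_subspaceW (modulus_continuous omega_modulus).
  by move=> y /=; rewrite !in_itv/= => /andP[->].
move=> /(_ ltr01)[_ + _]; rewrite (modulus0 omega_modulus) => /cvgr0Pnorm_lt.
move=> /(_ _ e0) h.
near (0 : R)^'+ => d; exists d => //.
by apply: le_lt_trans (ler_norm _) _; near: d.
Unshelve. all: by end_near. Qed.

End Modulus.

(** * The norm of a Hilbert space composed with the primitive *)

Section InnerProduct.
Variables (R : realType) (X : normedModType R) (dot : {dot X for idfun}).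
Hypothesis dot_norm : forall x : X, dot x x = `|x| ^+ 2.

Lemma dotC x y : dot x y = dot y x.
Proof. by rewrite hermC expr0 mul1r. Qed.

Lemma dotDl x y z : dot (x + y) z = dot x z + dot y z.
Proof. exact: linearDl. Qed.

Lemma dotDr x y z : dot z (x + y) = dot z x + dot z y.
Proof. exact: linearDr. Qed.

Lemma dotZl a x y : dot (a *: x) y = a * dot x y.
Proof. exact: linearZl_LR. Qed.

Lemma dotZr a x y : dot x (a *: y) = a * dot x y.
Proof. by rewrite dotC dotZl dotC. Qed.

Lemma dotNl x y : dot (- x) y = - dot x y.
Proof. exact: linearNl. Qed.

Lemma dotNr x y : dot x (- y) = - dot x y.
Proof. exact: linearNr. Qed.

Lemma dot0r x : dot x 0 = 0.
Proof. exact: linear0r. Qed.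

Lemma normD_sqr x y : `|x + y| ^+ 2 = `|x| ^+ 2 + 2 * dot x y + `|y| ^+ 2.
Proof.
rewrite -!dot_norm dotDl !dotDr [dot y x]dotC; ring.
Qed.

Lemma dot_le_norm x y : dot x y <= `|x| * `|y|.
Proof.
have : `|x + y| ^+ 2 <= (`|x| + `|y|) ^+ 2.
  by rewrite ler_sqr ?nnegrE ?addr_ge0// ler_normD.
rewrite normD_sqr; lra.
Qed.

Lemma norm_dot_le x y : `|dot x y| <= `|x| * `|y|.
Proof.
rewrite ler_norml dot_le_norm andbT lerNl -dotNr.
by rewrite -(normrN y) dot_le_norm.
Qed.

Variable omega : R -> R.
Hypothesis omega_modulus : modulus_of_continuity omega.
Local Notation phi := (modulus_primitive omega).

(** Let a = |w|, r = |h| and s = |w + h|, so that s^2 = a^2 + 2 <w, h> + r^2.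
    If r <= 2 a, the parabola touching phi at a bounds phi s by
    phi a + <v, h> + omega a r^2 / (2 a), and omega a / a <= omega (r/2) / (r/2)
    bounds the last term by r omega (r/2) <= 2 phi r. If r > 2 a, this term is
    too big and the parabola touching phi at b = r - a is used instead: b is the
    smallest possible value of s, reached when h points opposite to w, which is
    the extremal direction. *)
Lemma primitive_norm_superdifferential w : exists v : X, forall h,
  phi `|w + h| <= phi `|w| + dot v h + 2 * phi `|h|.
Proof.
have [->|w0] := eqVneq w 0.
  exists 0 => h; rewrite add0r normr0 primitive0 dotC dot0r.
  have := primitive_ge0 omega_modulus (normr_ge0 h); lra.
set a := `|w|; have a0 : 0 < a by rewrite normr_gt0.
exists ((omega a / a) *: w) => h; set r := `|h|; set s := `|w + h|.
have r0 : 0 <= r by exact: normr_ge0.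
have s0 : 0 <= s by exact: normr_ge0.
have sE : s ^+ 2 = a ^+ 2 + 2 * dot w h + r ^+ 2 by exact: normD_sqr.
rewrite dotZl.
have [ra|ar] := leP r (2 * a).
  have h1 := primitive_le_parabola omega_modulus a0 s0.
  have h2 : omega a * r ^+ 2 / (2 * a) <= 2 * phi r.
    have r20 : 0 <= r / 2 by lra.
    have r2a : r / 2 <= a by lra.
    have h3 := modulus_slope omega_modulus r20 r2a.
    have h4 := primitive_ge_tangent omega_modulus r20 r0.
    have h5 := primitive_ge0 omega_modulus r20.
    rewrite ler_pdivrMr ?mulr_gt0//.
    have : r * (r / 2 * omega a) <= r * (a * omega (r / 2)).
      by rewrite ler_wpM2l.
    nra.
  have e : omega a / (2 * a) * (s ^+ 2 - a ^+ 2) =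
      omega a / a * dot w h + omega a * r ^+ 2 / (2 * a).
    by rewrite sE; field; rewrite gt_eqF.
  lra.
set b := r - a.
have b0 : 0 < b by rewrite /b; lra.
have ab : a <= b by rewrite /b; lra.
have h1 := primitive_le_parabola omega_modulus b0 s0.
have h2 : omega b / b <= omega a / a.
  rewrite ler_pdivrMr// mulrAC ler_pdivlMr//.
  by have := modulus_slope omega_modulus (ltW a0) ab; lra.
have sb : s ^+ 2 - b ^+ 2 = 2 * (a * r + dot w h) by rewrite sE /b; ring.
have cs : 0 <= a * r + dot w h.
  have := norm_dot_le w h; rewrite ler_norml => /andP[+ _].
  by rewrite -/a -/r; lra.
have h3 : omega b / (2 * b) * (s ^+ 2 - b ^+ 2) <=
    omega a * r + omega a / a * dot w h.
  rewrite sb (_ : _ * _ = omega b / b * (a * r + dot w h)); last first.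
    by field; rewrite gt_eqF.
  apply: le_trans (ler_wpM2r cs h2) _.
  by rewrite le_eqVlt; apply/orP; left; apply/eqP; field; rewrite gt_eqF.
have h4 : phi b <= phi r by apply: primitive_le => //; rewrite /b; lra.
have h5 := primitive_ge_tangent omega_modulus (ltW a0) r0.
have h6 := primitive_ge_half_mul omega_modulus (ltW a0).
lra.
Qed.

End InnerProduct.

(** * Paraconvex functions and the sandwich theorem *)

Section Paraconvex.
Variables (R : realType) (X : normedModType R) (p : R -> R) (K : R).

(** The error is the one obtained by averaging, with weights l and 1 - l, two
    inequalities F (w + h) >= F w + T h - K p |h| with T linear, at the
    displacements h = (1 - l) d and h = - l d, whose average is 0. *)
Definition paraconvex (F : X -> R) := forall w d (l : R), 0 <= l <= 1 ->
  F w <= l * F (w + (1 - l) *: d) + (1 - l) * F (w - l *: d)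
         + K * (l * p ((1 - l) * `|d|) + (1 - l) * p (l * `|d|)).

(** F is the largest K-paraconvex function below all members of U. Its
    maximality is what makes - F paraconvex: translates of F, averages of those,
    and their sums with constants are paraconvex, and whenever they lie below
    U they lie below F. *)
Lemma paraconvex_sandwich (L U : set (X -> R)) : L !=set0 -> U !=set0 ->
  (forall m, L m -> paraconvex m) ->
  (forall g, U g -> paraconvex (fun x => - g x)) ->
  (forall m g x, L m -> U g -> m x <= g x) ->
  exists F : X -> R,
    [/\ paraconvex F, paraconvex (fun x => - F x),
        forall m x, L m -> m x <= F x & forall g x, U g -> F x <= g x].
Proof.
move=> [m0 Lm0] [g0 Ug0] Lpara Upara LU.
pose H : set (X -> R) :=
  [set m | paraconvex m /\ forall g x, U g -> m x <= g x].
pose V x := [set m x | m in H].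
have LH m : L m -> H m.
  by move=> Lm; split=> [|g x Ug]; [exact: Lpara|exact: LU].
have supV x : has_sup (V x).
  split; first by exists (m0 x), m0 => //; exact: LH.
  by exists (g0 x) => _ [m [_ mg] <-]; exact: mg.
pose F x := sup (V x).
have HF m x : H m -> m x <= F x.
  by move=> Hm; apply: ub_le_sup; [exact: (supV x).2|exists m].
have Fle x b : (forall m, H m -> m x <= b) -> F x <= b.
  move=> mb; apply: sup_le_ub; first exact: (supV x).1.
  by move=> _ [m Hm <-]; exact: mb.
have FU g x : U g -> F x <= g x by move=> Ug; apply: Fle => m [_]; exact.
have Fpara : paraconvex F.
  move=> w d l l01; apply: Fle => m Hm; apply: le_trans (Hm.1 w d l l01) _.
  have /andP[l0 l1] := l01.
  by rewrite lerD2r lerD// ler_wpM2l ?subr_ge0// HF.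
exists F; split=> // [|m x Lm]; last exact/HF/LH.
move=> w d l /[dup] l01 /andP[l0 l1].
set c := K * _.
(* the competitor in the definition of F, for this d and this l *)
suff /(HF _ w) : H (fun w => l * F (w + (1 - l) *: d)
    + (1 - l) * F (w - l *: d) - c) by lra.
split=> [w' d' k k01|g x Ug].
  have e1 k' a : w' + k' *: d' + a = w' + a + k' *: d' by rewrite addrAC.
  have e2 k' a : w' - k' *: d' + a = w' + a - k' *: d' by rewrite addrAC.
  rewrite !e1 !e2.
  have := ler_wpM2l l0 (Fpara (w' + (1 - l) *: d) d' k k01).
  have l10 : 0 <= 1 - l by rewrite subr_ge0.
  have := ler_wpM2l l10 (Fpara (w' - l *: d) d' k k01).
  lra.
have := Upara g Ug x d l l01; rewrite -/c.
have := ler_wpM2l l0 (FU g (x + (1 - l) *: d) Ug).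
have l10 : 0 <= 1 - l by rewrite subr_ge0.
have := ler_wpM2l l10 (FU g (x - l *: d) Ug).
lra.
Qed.

End Paraconvex.

(** * Differentiability of functions that are paraconvex with their opposite *)

Section Slopes.
Variables (R : realType) (X : normedModType R) (omega : R -> R).
Hypothesis omega_modulus : modulus_of_continuity omega.
Local Notation phi := (modulus_primitive omega).

(** Since phi s <= s omega s = o(s). All limits of difference quotients below
    are taken through this lemma. *)
Lemma le0_of_le_primitive (c C rho : R) : 0 <= C -> 0 <= rho ->
  (exists2 s0 : R, 0 < s0 &
    forall s, 0 < s -> s <= s0 -> s * c <= C * phi (s * rho)) -> c <= 0.
Proof.
move=> C0 rho0 [s0 s00 sc]; rewrite leNgt; apply/negP => c0.
have D0 : 0 < C * rho + 1 by rewrite ltr_wpDl ?mulr_ge0.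
have [d d0 dc] := modulus_small omega_modulus (divr_gt0 c0 D0).
have r10 : 0 < rho + 1 by rewrite ltr_wpDl.
pose s := Num.min s0 (d / (rho + 1)).
have s_gt0 : 0 < s by rewrite lt_min s00 divr_gt0.
have sr0 : 0 <= s * rho by rewrite mulr_ge0// ltW.
have srd : s * rho <= d.
  apply: (@le_trans _ _ (d / (rho + 1) * rho)).
    by rewrite ler_wpM2r// ge_min lexx orbT.
  by rewrite mulrAC ler_pdivrMr// ler_pM2l//; lra.
have ss0 : s <= s0 by rewrite ge_min lexx.
have h1 := sc s s_gt0 ss0.
have h2 := primitive_le_mul omega_modulus sr0.
have h3 := modulus_le omega_modulus sr0 srd.
have h4 : c <= C * rho * omega d.
  rewrite -(ler_pM2l s_gt0); apply: le_trans h1 _.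
  apply: le_trans (ler_wpM2l C0 h2) _.
  by have := ler_wpM2l (mulr_ge0 C0 sr0) h3; lra.
have Cr0 : 0 <= C * rho by rewrite mulr_ge0.
have h5 : omega d * (C * rho + 1) < c by rewrite -ltr_pdivlMr.
have := modulus_ge0 omega_modulus (ltW d0).
lra.
Qed.

Variables (K : R) (F : X -> R).
Hypothesis K_ge0 : 0 <= K.
Hypothesis F_para : paraconvex phi K F.
Hypothesis NF_para : paraconvex phi K (fun x => - F x).

(** Paraconvexity on the segment from z to z + s h, at its point z + t h: the
    difference quotient is nondecreasing in the step, up to K phi (t |h|) / t and
    K phi (s |h|) / s; denominators are cleared. *)
Lemma paraconvex_slope_le (H : X -> R) z h (t s : R) :
  paraconvex phi K H -> 0 < t -> t <= s ->
  s * (H (z + t *: h) - H z) <=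
  t * (H (z + s *: h) - H z + K * phi (s * `|h|)) + s * (K * phi (t * `|h|)).
Proof.
move=> Hpara t0 ts; have s0 : 0 < s by exact: lt_le_trans ts.
set l := t / s.
have l0 : 0 <= l by rewrite divr_ge0 ?ltW.
have l1 : l <= 1 by rewrite ler_pdivrMr// mul1r.
have tE : t = l * s by rewrite /l divfK// gt_eqF.
have e1 : z + t *: h + (1 - l) *: (s *: h) = z + s *: h.
  by rewrite -addrA scalerA -scalerDl tE; congr (_ + _ *: _); ring.
have e2 : z + t *: h - l *: (s *: h) = z.
  by rewrite scalerA -tE addrK.
have := Hpara (z + t *: h) (s *: h) l; rewrite l0 l1 e1 e2 => /(_ erefl).
rewrite normrZ (gtr0_norm s0) !mulrA -tE.
have r0 : 0 <= s * `|h| by rewrite mulr_ge0// ltW.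
have r1 : 0 <= t * `|h| by rewrite mulr_ge0// ltW.
have h1 : phi ((1 - l) * s * `|h|) <= phi (s * `|h|).
  apply: primitive_le => //; first by rewrite !mulr_ge0// ?subr_ge0// ltW.
  by rewrite ler_wpM2r// ler_piMl ?(ltW s0)//; lra.
have h2 := primitive_ge0 omega_modulus r1.
have h3 : K * (l * phi ((1 - l) * s * `|h|) + (1 - l) * phi (t * `|h|)) <=
    K * (l * phi (s * `|h|) + phi (t * `|h|)).
  rewrite ler_wpM2l// lerD// ?ler_wpM2l//; nra.
move=> h4; have h5 := le_trans h4 (lerD (lexx _) h3).
have := ler_wpM2l (ltW s0) h5; rewrite tE; lra.
Qed.

Lemma paraconvex_slope z h : exists c : R, forall s, 0 < s ->
  `|F (z + s *: h) - F z - s * c| <= K * phi (s * `|h|).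
Proof.
(* Every a s is at most every b s', as seen by comparing both with the
   difference quotient at a common small step t. The directional derivative is
   any number in between. *)
pose a s := (F (z + s *: h) - F z - K * phi (s * `|h|)) / s.
pose b s := (F (z + s *: h) - F z + K * phi (s * `|h|)) / s.
have ab s s' : 0 < s -> 0 < s' -> a s <= b s'.
  move=> s0 s'0; rewrite -subr_le0.
  apply: (@le0_of_le_primitive _ (2 * K) `|h|) => //; first by rewrite mulr_ge0.
  exists (Num.min s s'); first by rewrite lt_min s0.
  move=> t t0; rewrite le_min => /andP[ts ts'].
  have h1 := paraconvex_slope_le z h F_para t0 ts'.
  have h2 := paraconvex_slope_le z h NF_para t0 ts.
  have aE : F (z + s *: h) = F z + s * a s + K * phi (s * `|h|).
    by rewrite /a; field; rewrite gt_eqF.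
  have bE : F (z + s' *: h) - F z = s' * b s' - K * phi (s' * `|h|).
    by rewrite /b; field; rewrite gt_eqF.
  have h1' : F (z + t *: h) - F z <= t * b s' + K * phi (t * `|h|).
    rewrite -(ler_pM2l s'0); apply: le_trans h1 _; rewrite bE; lra.
  have h2' : F z - F (z + t *: h) <= - (t * a s) + K * phi (t * `|h|).
    rewrite -(ler_pM2l s0).
    rewrite [X in X <= _](_ : _ = s * (- F (z + t *: h) - - F z)); last by ring.
    apply: le_trans h2 _; rewrite aE; lra.
  lra.
pose V := [set a s | s in [set s : R | 0 < s]].
exists (sup V) => s s0.
have Vs : V (a s) by exists s.
have asV : a s <= sup V.
  by apply: ub_le_sup => //; exists (b s) => _ [s' s'0 <-]; exact: ab.
have Vbs : sup V <= b s.
  by apply: sup_le_ub; [exists (a s)|move=> _ [s' s'0 <-]; exact: ab].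
move: asV Vbs; rewrite ler_pdivrMr// ler_pdivlMr// => h1 h2.
rewrite ler_norml; apply/andP; split; lra.
Qed.

(** The directional derivatives of [paraconvex_slope] are linear in the
    direction: homogeneity holds by rescaling the step, and paraconvexity of F
    and - F at the midpoint of z + s h and z + s k gives additivity. The local
    bound on F is needed for the boundedness of D, as F is not assumed to be
    continuous. *)
Lemma paraconvex_differential z :
  (exists B, forall h, `|h| <= 1 -> `|F (z + h)| <= B) ->
  exists D : X -> R, [/\ forall h k, D (h + k) = D h + D k,
    forall (c : R) h, D (c *: h) = c * D h,
    exists B, forall h, `|D h| <= B * `|h| &
    forall h, `|F (z + h) - F z - D h| <= K * phi `|h|].
Proof.
move=> [B FB].
have [D DF] := choice (paraconvex_slope z).
have D1 h : `|F (z + h) - F z - D h| <= K * phi `|h|.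
  by have := DF h 1 ltr01; rewrite scale1r !mul1r.
have small (c C rho : R) : 0 <= C -> 0 <= rho ->
    (forall s, 0 < s -> `|s * c| <= C * phi (s * rho)) -> c = 0.
  move=> C0 rho0 sc; apply/eqP; rewrite eq_le; apply/andP; split.
    apply: (@le0_of_le_primitive _ C rho) => //; exists 1 => // s s0 _.
    exact: le_trans (ler_norm _) (sc s s0).
  rewrite -oppr_le0.
  apply: (@le0_of_le_primitive _ C rho) => //; exists 1 => // s s0 _.
  apply: le_trans (sc s s0); by rewrite mulrN -normrN ler_norm.
have phile s (u v : R) : 0 < s -> 0 <= u -> u <= v ->
    K * phi (s * u) <= K * phi (s * v).
  move=> s0 u0 uv; rewrite ler_wpM2l// primitive_le//.
    by rewrite mulr_ge0// ltW.
  by rewrite ler_pM2l.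
have Dpos (c : R) h : 0 < c -> D (c *: h) = c * D h.
  move=> c0; apply/eqP; rewrite -subr_eq0; apply/eqP.
  apply: (small _ (2 * K) (c * `|h|)); rewrite ?mulr_ge0 ?(ltW c0)// => s s0.
  have := DF (c *: h) s s0; have := DF h (s * c) (mulr_gt0 s0 c0).
  rewrite normrZ (gtr0_norm c0) scalerA mulrA !ler_norml.
  move=> /andP[? ?] /andP[? ?].
  apply/andP; split; lra.
have half0 : (0 : R) < 2^-1 by rewrite invr_gt0.
have Dmid h k : D (2^-1 *: (h + k)) = 2^-1 * D h + 2^-1 * D k.
  apply/eqP; rewrite -subr_eq0; apply/eqP.
  have r0 : 0 <= `|h| + `|k| by rewrite addr_ge0.
  apply: (small _ (3 * K) (`|h| + `|k|)); rewrite ?mulr_ge0// => s s0.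
  have nhk : `|h - k| <= `|h| + `|k| by rewrite -[`|k|]normrN ler_normD.
  have h1 := DF (2^-1 *: (h + k)) s s0.
  have h2 := DF h s s0; have h3 := DF k s s0.
  have l01 : 0 <= (2^-1 : R) <= 1 by rewrite invr_ge0 invf_le1//; lra.
  have h4 := F_para (z + s *: (2^-1 *: (h + k))) (s *: (h - k)) l01.
  have h5 := NF_para (z + s *: (2^-1 *: (h + k))) (s *: (h - k)) l01.
  have ha : (1 - 2^-1 : R) = 2^-1 by lra.
  have e1 : z + s *: (2^-1 *: (h + k)) + 2^-1 *: (s *: (h - k)) = z + s *: h.
    rewrite -addrA !scalerA [2^-1 * s]mulrC -scalerDr addrACA subrr addr0.
    by rewrite -mulr2n -[h *+ 2]scaler_nat scalerA mulfVK.
  have e2 : z + s *: (2^-1 *: (h + k)) - 2^-1 *: (s *: (h - k)) = z + s *: k.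
    rewrite -addrA !scalerA [2^-1 * s]mulrC -scalerBr opprB [h + k]addrC.
    rewrite addrACA subrr addr0.
    by rewrite -mulr2n -[k *+ 2]scaler_nat scalerA mulfVK.
  move: h4 h5; rewrite ha e1 e2 normrZ (gtr0_norm s0).
  have h6 : K * phi (2^-1 * (s * `|h - k|)) <= K * phi (s * (`|h| + `|k|)).
    rewrite mulrCA; apply: phile => //.
    by have := normr_ge0 (h - k); lra.
  have h7 : K * phi (s * `|2^-1 *: (h + k)|) <= K * phi (s * (`|h| + `|k|)).
    apply: phile => //; rewrite normrZ gtr0_norm//.
    by have := ler_normD h k; have := normr_ge0 (h + k); lra.
  have h8 : K * phi (s * `|h|) <= K * phi (s * (`|h| + `|k|)).
    by apply: phile => //; rewrite lerDl.
  have h9 : K * phi (s * `|k|) <= K * phi (s * (`|h| + `|k|)).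
    by apply: phile => //; rewrite lerDr.
  move: h1 h2 h3; rewrite !ler_norml => /andP[? ?] /andP[? ?] /andP[? ?] ? ?.
  apply/andP; split; lra.
have Dadd h k : D (h + k) = D h + D k.
  have := Dmid h k; rewrite Dpos//; lra.
have D0 : D 0 = 0 by have := Dadd 0 0; rewrite addr0; lra.
have DN h : D (- h) = - D h by have := Dadd h (- h); rewrite subrr D0; lra.
have Dscale (c : R) h : D (c *: h) = c * D h.
  have [c0|c0|->] := ltgtP c 0; last by rewrite scale0r D0 mul0r.
    by rewrite -[c in LHS]opprK scaleNr DN Dpos ?oppr_gt0// mulNr opprK.
  exact: Dpos.
exists D; split=> //.
exists (2 * B + K * phi 1) => h.
have [->|h0] := eqVneq h 0; first by rewrite D0 !normr0 mulr0.
have nh : 0 < `|h| by rewrite normr_gt0.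
have hE : h = `|h| *: (`|h|^-1 *: h) by rewrite scalerA divff ?scale1r// gt_eqF.
rewrite {1}hE Dscale normrM normr_id mulrC ler_pM2r//.
have u1 : `| (`|h|^-1 *: h) | = 1.
  by rewrite normrZ normfV normr_id mulVf// gt_eqF.
have := D1 (`|h|^-1 *: h); have := FB (`|h|^-1 *: h); have := FB 0.
rewrite u1 normr0 ler01 lexx addr0 => /(_ erefl) + /(_ erefl).
rewrite !ler_norml => /andP[? ?] /andP[? ?] /andP[? ?].
by apply/andP; split; lra.
Qed.

End Slopes.

(** * Riesz representation *)

Section Riesz.
Variables (R : realType) (X : completeNormedModType R).
Variable dot : {dot X for idfun}.
Hypothesis dot_norm : forall x : X, dot x x = `|x| ^+ 2.

(** The representative is the minimizer of J x = |x|^2 - 2 D x. Minimizing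
    sequences are Cauchy by the parallelogram identity, and the Euler-Lagrange
    equation of J at its minimizer v is D h = <v, h>. *)
Lemma riesz_representation (D : X -> R) :
  (forall h k, D (h + k) = D h + D k) ->
  (forall (c : R) h, D (c *: h) = c * D h) ->
  (exists B, forall h, `|D h| <= B * `|h|) ->
  exists v, forall h, D h = dot v h.
Proof.
move=> DD DZ [B0 DB0].
pose B := `|B0|; have B_ge0 : 0 <= B by exact: normr_ge0.
have DB h : `|D h| <= B * `|h|.
  by apply: le_trans (DB0 h) _; rewrite ler_wpM2r// ler_norm.
pose J x := `|x| ^+ 2 - 2 * D x.
have JD x h : J (x + h) = J x + 2 * (dot x h - D h) + `|h| ^+ 2.
  by rewrite /J (normD_sqr dot_norm) DD; ring.
have JB x : - B ^+ 2 <= J x.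
  have := le_trans (ler_norm _) (DB x); rewrite /J.
  have := sqr_ge0 (`|x| - B); rewrite sqrrB; lra.
pose V := [set J x | x in [set: X]].
have Vinf : has_inf V.
  by split; [exists (J 0), 0|exists (- B ^+ 2) => _ [x _ <-]].
set m := inf V.
have mJ x : m <= J x by apply: ge_inf; [exact: Vinf.2|exists x].
have near_min (n : nat) : exists x, J x < m + n.+1%:R^-1.
  have n0 : 0 < n.+1%:R^-1 :> R by rewrite invr_gt0 ltr0n.
  by have [_ [x _ <-] xe] := inf_adherent n0 Vinf; exists x.
have [x_ Jx] := choice near_min.
(* the parallelogram identity and m <= J ((x + y) / 2) *)
have par x y : `|x - y| ^+ 2 <= 2 * (J x - m) + 2 * (J y - m).
  have := mJ (2^-1 *: (x + y)).
  have hx := normD_sqr dot_norm x y; have hy := normD_sqr dot_norm x (- y).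
  rewrite dotNr normrN in hy; move: hy.
  rewrite /J DZ DD normrZ exprMn hx ger0_norm ?invr_ge0//.
  rewrite (_ : 2^-1 ^+ 2 = 4^-1 :> R); last by rewrite exprVn -natrX.
  lra.
have small (e : R) : 0 < e -> exists N, forall n, (N <= n)%N -> n.+1%:R^-1 < e.
  move=> e0; exists (Num.truncn e^-1) => n Nn.
  rewrite invf_plt ?posrE//.
  by apply: lt_le_trans (truncnS_gt _) _; rewrite ler_nat ltnS.
have cx : cvgn x_.
  apply/cauchy_cvgP/cauchy_exP => e e0.
  have e2 : 0 < e ^+ 2 / 4 by rewrite divr_gt0// exprn_gt0.
  have [N NP] := small _ e2.
  exists (x_ N), N => // n /= Nn; rewrite -ball_normE /ball_/=.
  rewrite -(@ltr_pXn2r _ 2)// ?nnegrE ?(ltW e0)//.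
  have := par (x_ N) (x_ n); have := Jx N; have := Jx n.
  have := NP n Nn; have := NP N (leqnn N).
  by move: N.+1%:R^-1 n.+1%:R^-1 => a b; lra.
set v := limn x_ in cx.
have Jv : J v <= m.
  apply/ler_addgt0Pr => e e0.
  set C := 1 + 2 * `|v| + 3 + 2 * B.
  have C0 : 0 < C by have := normr_ge0 v; rewrite /C; lra.
  pose d := Num.min 1 (e / C).
  have d0 : 0 < d by rewrite lt_min ltr01 divr_gt0.
  have d1 : d <= 1 by rewrite ge_min lexx.
  have dd : d * d <= d by rewrite ler_piMr// ltW.
  have dC : d * C <= e by rewrite -ler_pdivlMr// ge_min lexx orbT.
  have [N NP] := small _ d0.
  have /cvgrPdist_lt /(_ d d0) [N' _ N'P] := cx.
  pose n := maxn N N'.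
  have hn : n.+1%:R^-1 < d by apply: NP; rewrite leq_maxl.
  have hv : `|v - x_ n| < d by apply: N'P; rewrite /= leq_maxr.
  have xv : `|x_ n| <= `|v| + d.
    have := ler_normB v (v - x_ n); rewrite opprB addrC subrK; lra.
  have := JD (x_ n) (v - x_ n); rewrite addrC subrK => ->.
  have h1 : J (x_ n) < m + d by apply: lt_trans (Jx n) _; rewrite ltrD2l.
  have h2 := dot_le_norm dot_norm (x_ n) (v - x_ n).
  have h3 : - D (v - x_ n) <= B * d.
    have := DB (v - x_ n); rewrite ler_norml => /andP[h _].
    have := ler_wpM2l B_ge0 (ltW hv); lra.
  have h4 : `|x_ n| * `|v - x_ n| <= (`|v| + d) * d.
    by rewrite ler_pM// ltW.
  have h5 : `|v - x_ n| ^+ 2 <= d.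
    by rewrite expr2; apply: le_trans (ler_pM _ _ (ltW hv) (ltW hv)) _.
  have h6 : (`|v| + d) * d <= `|v| * d + d by rewrite mulrDl lerD2l.
  rewrite /C in dC; lra.
exists v => h.
(* J v <= m <= J (v + t h) *)
have key t : 0 <= 2 * t * (dot v h - D h) + t ^+ 2 * `|h| ^+ 2.
  have := mJ (v + t *: h).
  rewrite JD dotZr DZ normrZ exprMn real_normK ?num_real//.
  lra.
have [->|h0] := eqVneq h 0.
  by rewrite dot0r; have := DZ 0 0; rewrite scale0r mul0r.
have hh : 0 < `|h| ^+ 2 by rewrite exprn_gt0// normr_gt0.
(* the step that minimizes the right-hand side of key *)
have := key (- (dot v h - D h) / `|h| ^+ 2).
set c := dot v h - D h.
rewrite (_ : _ + _ = - (c ^+ 2 / `|h| ^+ 2)); last by field; rewrite normr_eq0.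
rewrite oppr_ge0 pmulr_lle0 ?invr_gt0// => c2.
have : c ^+ 2 == 0 by rewrite eq_le c2 sqr_ge0.
by rewrite sqrf_eq0 subr_eq0 => /eqP.
Qed.

End Riesz.

(** * Gradients and Taylor estimates *)

Section Gradient.
Variables (R : realType) (X : normedModType R) (dot : {dot X for idfun}).
Hypothesis dot_norm : forall x : X, dot x x = `|x| ^+ 2.

Lemma dot_continuous v : continuous (dot v).
Proof.
apply: (@bounded_linear_continuous _ _ _ (dot v : {linear X -> R})).
apply/linear_boundedP; near=> r => x.
apply: le_trans (norm_dot_le dot_norm v x) _.
by rewrite ler_wpM2r//; near: r; exact: nbhs_pinfty_ge.
Unshelve. all: by end_near. Qed.

Variable omega : R -> R.
Hypothesis omega_modulus : modulus_of_continuity omega.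
Local Notation phi := (modulus_primitive omega).

Lemma gradient_of_remainder (F : X -> R) x v (K : R) : 0 <= K ->
  (forall h, `|F (x + h) - F x - dot v h| <= K * phi `|h|) ->
  differentiable F x /\ gradient dot F x = v.
Proof.
move=> K0 Fv.
have Fo : F \o shift x = cst (F x) + dot v +o_ (0 : X) id.
  apply/eqaddoP => e e0.
  have K1 : 0 < K + 1 by lra.
  have [d d0 od] := modulus_small omega_modulus (divr_gt0 e0 K1).
  near=> h => /=.
  rewrite (_ : (_ - _) h = F (x + h) - F x - dot v h); last first.
    by rewrite !fctE [h + x]addrC opprD addrA.
  apply: le_trans (Fv h) _.
  have hd : `|h| <= d by near: h; apply: nbhs0_le.
  have h1 := primitive_le_mul omega_modulus (normr_ge0 h).
  have h2 := modulus_le omega_modulus (normr_ge0 h) hd.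
  move: od; rewrite ltr_pdivlMr// => od.
  have h0 := normr_ge0 h; have o0 := modulus_ge0 omega_modulus (ltW d0).
  apply: le_trans (ler_wpM2l K0 h1) _.
  apply: (@le_trans _ _ (K * (`|h| * omega d))).
    by rewrite ler_wpM2l// ler_wpM2l.
  rewrite mulrCA [e * _]mulrC ler_wpM2l//; lra.
have dF := diff_unique (@dot_continuous v) Fo.
split.
  apply/diff_locallyP; rewrite dF; split=> //; exact: dot_continuous.
apply: xget_unique => [h|u uF]; first by rewrite dF.
have e h : dot (u - v) h = 0 by rewrite dotDl dotNl -uF dF subrr.
apply/eqP; rewrite -subr_eq0 -normr_eq0 -sqrf_eq0 -dot_norm e//.
Unshelve. all: by end_near. Qed.

End Gradient.

(** * Extension of jets *)

Section Jets.
Variables (R : realType) (X : completeNormedModType R).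
Variable dot : {dot X for idfun}.
Hypothesis dot_norm : forall x : X, dot x x = `|x| ^+ 2.
Variable omega : R -> R.
Hypothesis omega_modulus : modulus_of_continuity omega.
Local Notation phi := (modulus_primitive omega).

Lemma jetA_le (E : set X) (f : X -> R) (G : X -> X) (K : R) : 0 <= K ->
  (forall x y z, E y -> E z ->
    `|f y + dot (G y) (x - y) - f z - dot (G z) (x - z)| <=
    K * (phi `|x - y| + phi `|x - z|)) ->
  (jetA dot omega E f G <= K%:E)%E.
Proof.
move=> K0 fK; rewrite /jetA ge_max lee_fin K0/=.
apply: ge_ereal_sup => _ [x [y [z [Ey Ez xyz ->]]]].
rewrite lee_fin ler_pdivrMr; first exact: fK.
have hy := primitive_ge0 omega_modulus (normr_ge0 (x - y)).
have hz := primitive_ge0 omega_modulus (normr_ge0 (x - z)).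
have [xy|xy] := ltP 0 `|x - y|.
  by rewrite ltr_pwDl// primitive_gt0.
by rewrite ltr_wpDl// primitive_gt0//; lra.
Qed.

(** When x = y = z the triple is excluded from the supremum, but both sides of
    the bound vanish. *)
Lemma jetA_bound (E : set X) (f : X -> R) (G : X -> X) :
  (jetA dot omega E f G < +oo)%E -> exists2 M : R,
    0 <= M /\ jetA dot omega E f G = M%:E &
    forall x y z, E y -> E z ->
    `|f y + dot (G y) (x - y) - f z - dot (G z) (x - z)| <=
    M * (phi `|x - y| + phi `|x - z|).
Proof.
move=> Aoo.
have A0 : (0 <= jetA dot omega E f G)%E by rewrite /jetA le_max lexx.
have [M AM] : exists M : R, jetA dot omega E f G = M%:E.
  by exists (fine (jetA dot omega E f G)); rewrite fineK// ge0_fin_numE.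
have M0 : 0 <= M by rewrite -lee_fin -AM.
exists M => // x y z Ey Ez.
have hy := primitive_ge0 omega_modulus (normr_ge0 (x - y)).
have hz := primitive_ge0 omega_modulus (normr_ge0 (x - z)).
have [xyz|xyz] := ltP 0 (`|x - y| + `|x - z|); last first.
  have nx := normr_ge0 (x - y); have nz := normr_ge0 (x - z).
  have /eqP : `|x - y| = 0 by lra.
  have /eqP : `|x - z| = 0 by lra.
  rewrite !normr_eq0 !subr_eq0 => /eqP <- /eqP <-.
  rewrite subrr !dot0r addr0 subr0 subrr !normr0 primitive0 addr0 mulr0.
  exact: lexx.
have p0 : 0 < phi `|x - y| + phi `|x - z|.
  have [xy|xy] := ltP 0 `|x - y|; first by rewrite ltr_pwDl// primitive_gt0.
  by rewrite ltr_wpDl// primitive_gt0//; lra.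
rewrite -ler_pdivrMr// -lee_fin -AM /jetA le_max; apply/orP; right.
by apply: ereal_sup_ubound; exists x, y, z.
Qed.

Lemma jet_of_remainder (F : X -> R) (g : X -> X) (K : R) x y z :
  (forall z h, `|F (z + h) - F z - dot (g z) h| <= K * phi `|h|) ->
  `|F y + dot (g y) (x - y) - F z - dot (g z) (x - z)| <=
    K * (phi `|x - y| + phi `|x - z|).
Proof.
move=> FK; have := FK y (x - y); have := FK z (x - z).
rewrite ![_ + (x - _)]addrCA !subrr !addr0 mulrDr.
move: (dot (g y) _) (dot (g z) _) (K * _) (K * _) (F x) (F y) (F z).
move=> a b c d p q r; rewrite !ler_norml => /andP[? ?] /andP[? ?].
by apply/andP; split; lra.
Qed.

(** For v of length r = |y - z| in the direction of g y - g z, the three Taylor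
    estimates along the edges of the triangle z, y, y + v add up to
    r |g y - g z| <= K (2 phi r + phi (2 r)) <= 6 K r omega r. *)
Lemma jet_modulus_of_remainder (F : X -> R) (g : X -> X) (K : R) : 0 <= K ->
  (forall z h, `|F (z + h) - F z - dot (g z) h| <= K * phi `|h|) ->
  forall y z, `|g y - g z| <= 6 * K * omega `|y - z|.
Proof.
move=> K0 FK y z; set r := `|y - z|; set u := g y - g z.
have r0 : 0 <= r by exact: normr_ge0.
have [->|u0] := eqVneq u 0.
  by rewrite normr0 !mulr_ge0// (modulus_ge0 omega_modulus).
have nu : 0 < `|u| by rewrite normr_gt0.
have [rE|rn0] := eqVneq r 0.
  have yz : y = z by apply/eqP; rewrite -subr_eq0 -normr_eq0 -/r rE.
  by move: u0; rewrite /u yz subrr eqxx.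
have rpos : 0 < r by rewrite lt_neqAle eq_sym rn0.
pose v := (r / `|u|) *: u.
have vr : `|v| = r.
  by rewrite normrZ normrM normfV !normr_id divfK// gt_eqF.
have uv : dot u v = r * `|u|.
  by rewrite dotZr dot_norm; field; rewrite gt_eqF.
have h1 := FK y v; have h2 := FK z (y - z); have h3 := FK z (y - z + v).
rewrite addrCA subrr addr0 in h2.
rewrite addrA [z + (y - z)]addrCA subrr addr0 dotDr in h3.
rewrite vr in h1; rewrite -/r in h2.
have h4 : phi `|y - z + v| <= phi (2 * r).
  apply: primitive_le => //; apply: le_trans (ler_normD _ _) _.
  by rewrite vr -/r; lra.
have h5 : phi (2 * r) <= 4 * (r * omega r).
  have r2 : 0 <= 2 * r by lra.
  have rr : r <= 2 * r by lra.
  apply: le_trans (primitive_le_mul omega_modulus r2) _.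
  have := modulus_slope omega_modulus r0 rr; lra.
have h6 := primitive_le_mul omega_modulus r0.
have h7 : K * phi `|y - z + v| <= K * (4 * (r * omega r)).
  by rewrite ler_wpM2l// (le_trans h4).
have h8 := ler_wpM2l K0 h6.
have uv' : dot u v = dot (g y) v - dot (g z) v by rewrite dotDl dotNl.
rewrite -(ler_pM2l rpos) -uv uv'.
move: h1 h2 h3; rewrite !ler_norml => /andP[? ?] /andP[? ?] /andP[? ?].
lra.
Qed.

Lemma diff_gradient (F : X -> R) x h : differentiable F x ->
  'd F x h = dot (gradient dot F x) h.
Proof.
move=> dF.
have [|||v vE] := @riesz_representation _ _ _ dot_norm ('d F x).
- by move=> a b; rewrite linearD.
- by move=> c a; rewrite linearZ.
- have /linear_bounded_continuous/linear_boundedP := diff_continuous dF.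
  by move=> /pinfty_ex_gt0[B _ FB]; exists B.
suff /(_ h) : [set v | forall h, 'd F x h = dot v h] (gradient dot F x) by [].
by apply: xgetPex; exists v.
Qed.

(** The mean value theorem on the segment from z to z + h bounds the remainder
    by C omega |h| |h|, and t omega t <= 2 phi t. *)
Lemma C1omega_remainder (F : X -> R) : C1omega dot omega F ->
  exists2 K : R, 0 <= K &
    forall z h, `|F (z + h) - F z - dot (gradient dot F z) h| <= K * phi `|h|.
Proof.
move=> [dF [C C0 FC]]; exists (2 * C); first by rewrite mulr_ge0// ltW.
move=> z h.
pose k (t : R) := F (z + t *: h) - t * dot (gradient dot F z) h.
pose dk (t : R) := dot (gradient dot F (z + t *: h) - gradient dot F z) h.
have kd (t : R) : is_derive t 1 k (dk t).
  have line : is_diff t (fun t : R => z + t *: h) (fun s => s *: h).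
    apply: is_diff_eq; rewrite add0r.
    by apply/funext => s.
  have comp : is_diff t (F \o (fun t : R => z + t *: h))
      ('d F (z + t *: h) \o (fun s => s *: h)).
    apply: is_diff_comp; apply: differentiableP; exact: dF.
  have : is_derive t 1 (F \o (fun t : R => z + t *: h))
      (dot (gradient dot F (z + t *: h)) h).
    split; first exact/diff_derivable/ex_diff.
    rewrite deriveE; last exact: ex_diff.
    by rewrite diff_val /= scale1r diff_gradient.
  move=> c1; apply: is_derive_eq.
  by rewrite /dk dotDl dotNl scaler0 add0r /GRing.scale/= mulr1.
have [t t01 kE] : exists2 t, t \in `[0, 1] & k 1 - k 0 = dk t * (1 - 0).
  apply: MVT_segment ler01 (fun x _ => kd x) _.
  by apply: derivable_within_continuous => x _; exact: ex_derive.
have -> : F (z + h) - F z - dot (gradient dot F z) h = dk t.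
  rewrite -[RHS]mulr1 -[X in _ * X]subr0 -kE /k scale1r scale0r addr0; ring.
apply: le_trans (norm_dot_le dot_norm _ _) _.
move: t01; rewrite in_itv/= => /andP[t0 t1].
have h1 := FC (z + t *: h) z.
rewrite addrAC subrr add0r normrZ (ger0_norm t0) in h1.
have h2 : omega (t * `|h|) <= omega `|h|.
  by apply: modulus_le => //; [rewrite mulr_ge0|rewrite ler_piMl].
have h3 := primitive_ge_half_mul omega_modulus (normr_ge0 h).
have h4 := le_trans h1 (ler_wpM2l (ltW C0) h2).
apply: le_trans (ler_wpM2r (normr_ge0 h) h4) _.
have := ler_wpM2l (ltW C0) h3; lra.
Qed.

Lemma paraconvex_affine_sub (a M : R) (v y : X) : 0 <= M ->
  paraconvex phi (2 * M) (fun x => a + dot v (x - y) - M * phi `|x - y|).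
Proof.
move=> M0 w d l /andP[l0 l1].
have l10 : 0 <= 1 - l by rewrite subr_ge0.
have [u uP] := primitive_norm_superdifferential dot_norm omega_modulus (w - y).
have h1 := ler_wpM2l (mulr_ge0 M0 l0) (uP ((1 - l) *: d)).
have h2 := ler_wpM2l (mulr_ge0 M0 l10) (uP (- (l *: d))).
move: h1 h2; rewrite normrN !normrZ !ger0_norm//.
rewrite ![w + _ - y]addrAC ![dot _ (w - y + _)]dotDr !dotNr !dotZr.
lra.
Qed.

Lemma paraconvex_gradient (F : X -> R) (K : R) : 0 <= K ->
  paraconvex phi K F -> paraconvex phi K (fun x => - F x) ->
  (forall z, exists B, forall h, `|h| <= 1 -> `|F (z + h)| <= B) ->
  forall z, differentiable F z /\
    forall h, `|F (z + h) - F z - dot (gradient dot F z) h| <= K * phi `|h|.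
Proof.
move=> K0 Fp NFp FB z.
have [D [DD DZ DB FD]] :=
  paraconvex_differential omega_modulus K0 Fp NFp (FB z).
have [v vD] := riesz_representation dot_norm DD DZ DB.
have Fv h : `|F (z + h) - F z - dot v h| <= K * phi `|h| by rewrite -vD.
by have [dF ->] := gradient_of_remainder dot_norm omega_modulus K0 Fv.
Qed.

(** On E the extension lies between lower and upper functions having the same
    value and the same tangent, hence the Taylor estimate at a point of E with
    the prescribed value and gradient; elsewhere it comes from paraconvexity. *)
Lemma jet_extension (E : set X) (f : X -> R) (G : X -> X) (M : R) :
  E !=set0 -> 0 <= M ->
  (forall x y z, E y -> E z ->
    `|f y + dot (G y) (x - y) - f z - dot (G z) (x - z)| <=
    M * (phi `|x - y| + phi `|x - z|)) ->
  exists F : X -> R,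
    [/\ forall x, differentiable F x,
        forall x, E x -> F x = f x /\ gradient dot F x = G x &
        forall z h, `|F (z + h) - F z - dot (gradient dot F z) h|
          <= 2 * M * phi `|h|].
Proof.
move=> [y0 Ey0] M0 fM.
pose lo y x := f y + dot (G y) (x - y) - M * phi `|x - y|.
pose up y x := f y + dot (G y) (x - y) + M * phi `|x - y|.
have [||m [y Ey <-]|g [y Ey <-]|m g x [z Ez <-] [y Ey <-]|F [Fp NFp loF Fup]] :=
  @paraconvex_sandwich _ X phi (2 * M) [set lo y | y in E] [set up y | y in E].
- by exists (lo y0), y0.
- by exists (up y0), y0.
- exact: paraconvex_affine_sub.
- rewrite (_ : (fun _ => _) =
      (fun x => - f y + dot (- G y) (x - y) - M * phi `|x - y|)).
    exact: paraconvex_affine_sub.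
  by apply/funext => x; rewrite /up dotNl; ring.
- have := fM x y z Ey Ez; rewrite ler_norml /lo /up => /andP[? ?]; lra.
have {}loF y x : E y -> lo y x <= F x by move=> Ey; apply: loF; exists y.
have {}Fup y x : E y -> F x <= up y x by move=> Ey; apply: Fup; exists y.
have M20 : 0 <= 2 * M by rewrite mulr_ge0.
have FB z : exists B, forall h, `|h| <= 1 -> `|F (z + h)| <= B.
  pose r := `|z - y0| + 1.
  exists (`|f y0| + `|G y0| * r + M * phi r) => h h1.
  have rh : `|z + h - y0| <= r.
    by rewrite addrAC (le_trans (ler_normD _ _))// lerD2l.
  have a1 : M * phi `|z + h - y0| <= M * phi r.
    by rewrite ler_wpM2l// primitive_le.
  have a2 : `|dot (G y0) (z + h - y0)| <= `|G y0| * r.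
    by apply: le_trans (norm_dot_le dot_norm _ _) _; rewrite ler_wpM2l.
  have := loF y0 (z + h) Ey0; have := Fup y0 (z + h) Ey0; rewrite /lo /up.
  have := ler_norm (f y0); have := ler_norm (- f y0); rewrite normrN.
  move: a2; rewrite !ler_norml => /andP[? ?] ? ? ? ?.
  by apply/andP; split; lra.
have Fgrad := paraconvex_gradient M20 Fp NFp FB.
exists F; split=> [x|y Ey|z]; [exact: (Fgrad x).1| |exact: (Fgrad z).2].
have Fy : F y = f y.
  have := loF y y Ey; have := Fup y y Ey.
  by rewrite /lo /up subrr dot0r normr0 primitive0; lra.
split=> //; apply: (gradient_of_remainder dot_norm omega_modulus M0 _).2 => h.
have := loF y (y + h) Ey; have := Fup y (y + h) Ey.
rewrite /lo /up Fy [y + h]addrC addrK => ? ?.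
by rewrite ler_norml; apply/andP; split; lra.
Qed.

End Jets.

Unset Implicit Arguments.

Theorem theorem1p6 (R : realType) (X : completeNormedModType R)
    (dot : {dot X for idfun}) (dot_norm : forall x : X, dot x x = `|x| ^+ 2)
    (omega : R -> R) (omega_modulus : modulus_of_continuity omega)
    (E : set X) (E_nonempty : E !=set0) (f : X -> R) (G : X -> X) :
  ((exists F : X -> R, C1omega dot omega F /\
      (forall x, E x -> F x = f x /\ gradient dot F x = G x))
   <-> (jetA dot omega E f G < +oo)%E) /\
  ((jetA dot omega E f G < +oo)%E ->
   exists F : X -> R,
     [/\ C1omega dot omega F,
         (forall x, E x -> F x = f x /\ gradient dot F x = G x) &
         (jetA dot omega [set: X] F (gradient dot F)
            <= 2%:E * jetA dot omega E f G)%E]).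
Proof.
have ext : (jetA dot omega E f G < +oo)%E -> exists F : X -> R,
     [/\ C1omega dot omega F,
         (forall x, E x -> F x = f x /\ gradient dot F x = G x) &
         (jetA dot omega [set: X] F (gradient dot F)
            <= 2%:E * jetA dot omega E f G)%E].
  move=> /(jetA_bound omega_modulus)[M [M0 ->] fM].
  have [F [dF FE FM]] := jet_extension dot_norm omega_modulus E_nonempty M0 fM.
  have M20 : 0 <= 2 * M by rewrite mulr_ge0.
  exists F; split=> //; last first.
    rewrite -EFinM; apply: jetA_le => // x y z _ _; exact: jet_of_remainder.
  split=> //; exists (6 * (2 * M) + 1); first by rewrite ltr_wpDl// mulr_ge0.
  move=> x y; apply: le_trans
    (jet_modulus_of_remainder dot_norm omega_modulus M20 FM x y) _.
  by rewrite ler_wpM2r ?(modulus_ge0 omega_modulus)// lerDl.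
split=> //; split=> [[F [FC FE]]|/ext[F [FC FE _]]]; last by exists F.
have [K K0 FK] := C1omega_remainder dot_norm omega_modulus FC.
apply: (@le_lt_trans _ _ K%:E); last exact: ltry.
apply: jetA_le => // x y z Ey Ez.
have [<- <-] := FE y Ey; have [<- <-] := FE z Ez.
exact: jet_of_remainder.
Qed.
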